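(* Let $0\le m\le n$ be integers, $l=n-m$, $\lambda\in\mathbb{F}_q^*$, and let $\chi=((\alpha_i)_{i=1}^m,(\beta_i)_{i=1}^m,(\gamma_j)_{j=1}^l,(\psi_{c_j})_{j=1}^l)$ be a character of $G=(\mathbb{F}_q^* )^{2m+l}\times\mathbb{F}_q^l$, where $\alpha_i,\beta_i,\gamma_j$ are characters of $\mathbb{F}_q^*$ and $c_j\in\mathbb{F}_q^*$; put $c=\prod_{j=1}^lc_j$. If $\alpha_i\beta_i\ne\varepsilon$ for all $i$, then $$N({}_mX_{n,\lambda};\chi)=(-1)^{n+1}\Big(\prod_{j=1}^lg(\gamma_j)\overline{\gamma_j}(c_j)\prod_{i=1}^mj(\alpha_i,\beta_i)\Big)F\left({\alpha_1,\dots,\alpha_m\atop\overline{\beta_1},\dots,\overline{\beta_m},\overline{\gamma_1},\dots,\overline{\gamma_l}};c\lambda\right)_\psi.$$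
   Context: $q$ is a power of a prime $p$, $N=q-1$, $\psi$ a fixed nontrivial additive character of $\mathbb{F}_q$, $\psi_a(x)=\psi(ax)$. For multiplicative characters $\eta$: $\eta(0)=0$, $\overline\eta=\eta^{-1}$, $\varepsilon$ trivial, $\delta(\eta)=1$ iff $\eta=\varepsilon$. $g(\eta)=-\sum_{x\in\mathbb{F}_q^*}\psi(x)\eta(x)$, $g^\circ(\eta)=q^{\delta(\eta)}g(\eta)$, $j(\eta_1,\eta_2)=-\sum_{x_1+x_2=1,\,x_i\ne0}\eta_1(x_1)\eta_2(x_2)$, $(\alpha)_\nu=g(\alpha\nu)/g(\alpha)$, $(\alpha)^\circ_\nu=g^\circ(\alpha\nu)/g^\circ(\alpha)$. For characters $\alpha_1,\dots,\alpha_m,\beta_1,\dots,\beta_r$ and $\lambda\in\mathbb{F}_q$, $F\left({\alpha_1,\dots,\alpha_m\atop\beta_1,\dots,\beta_r};\lambda\right)_\psi=\frac1{1-q}\sum_{\nu}\frac{(\alpha_1)_\nu\cdots(\alpha_m)_\nu}{(\beta_1)^\circ_\nu\cdots(\beta_r)^\circ_\nu}\nu(\lambda)$, sum over all characters $\nu$ of $\mathbb{F}_q^*$. ${}_mX_{n,\lambda}$ is the affine variety over $\mathbb{F}_q$ in coordinates $(x_i,y_i,z_j,t_j)$ ($1\le i\le m$, $1\le j\le l$) defined by $x_i^N+y_i^N=1$, $t_j^q-t_j=z_j^N$, $(-1)^n\lambda\prod_ix_i^N=\prod_iy_i^N\prod_jz_j^N$, $\prod_ix_iy_i\prod_jz_j\ne0$.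 $G$ acts by $(\xi_i,\xi'_i,\zeta_j,a_j)\cdot(x_i,y_i,z_j,t_j)=(\xi_ix_i,\xi'_iy_i,\zeta_jz_j,t_j+a_j)$, and $\chi(\xi_i,\xi'_i,\zeta_j,a_j)=\prod_i\alpha_i(\xi_i)\beta_i(\xi'_i)\prod_j\gamma_j(\zeta_j)\psi(c_ja_j)$. For a variety $X$ over $\mathbb{F}_q$ with an action of a finite abelian group $G$ and a character $\chi$ of $G$, $N(X;\chi)=\frac1{\#G}\sum_{g\in G}\chi(g)\#\{P\in X(\overline{\mathbb{F}}_q):\mathrm{Frob}(P)=g\cdot P\}$, $\mathrm{Frob}$ the $q$-Frobenius. *)

(* Defs.v *)
From HB Require Import structures.
From mathcomp Require Import all_boot all_order all_algebra all_fingroup.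
From mathcomp Require Import all_solvable all_field all_character.
From mathcomp Require Import finmap boolp classical_sets cardinality.

Set Implicit Arguments.
Unset Strict Implicit.
Unset Printing Implicit Defensive.

Import Order.TTheory GRing.Theory Num.Theory.
Local Open Scope ring_scope.

(* Characters of the finite abelian groups F^* and (F, +) are the linear
   characters, with values in algC, of mathcomp's character theory.  The product
   and inverse of characters are the pointwise ring operations of 'CF(_), and
   the trivial character is 1. *)
Notation mulcfun F := 'CF([set: {unit F}]%G).
Notation addcfun F := 'CF([set: F]%G).

Section Hypergeometric.

Variable F : finFieldType.

Lemma mulchar_irr_lin (i : Iirr [set: {unit F}]%G) :
  'chi_i \is a linear_char.
Proof.
apply/char_abelianP/centsP => x _ y _; apply/val_inj.
by rewrite !FinRing.val_unitM mulrC.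
Qed.

Definition mulchar_ext (eta : mulcfun F) (x : F) : algC :=
  if insub x is Some u then eta u else 0.

Variable psi : addcfun F.

Definition gauss (eta : mulcfun F) : algC :=
  - \sum_(x : {unit F}) psi (val x) * eta x.

Definition gausso (eta : mulcfun F) : algC :=
  #|F|%:R ^+ (eta == 1) * gauss eta.

Definition jacobi (eta1 eta2 : mulcfun F) : algC :=
  - \sum_(x1 : {unit F}) \sum_(x2 : {unit F} | val x1 + val x2 == 1 :> F)
      eta1 x1 * eta2 x2.

Definition poch (alpha nu : mulcfun F) : algC :=
  gauss (alpha * nu) / gauss alpha.

Definition pocho (alpha nu : mulcfun F) : algC :=
  gausso (alpha * nu) / gausso alpha.

(* By mulchar_irr_lin, the sum over irreducible characters of F^* is the sum
   over all its characters. *)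
Definition hypergeom (alphas betas : seq (mulcfun F)) (lambda : F) : algC :=
  (1 - #|F|%:R)^-1 *
  \sum_(i : Iirr [set: {unit F}]%G)
    (\prod_(alpha <- alphas) poch alpha 'chi_i) /
    (\prod_(beta <- betas) pocho beta 'chi_i) * mulchar_ext 'chi_i lambda.

End Hypergeometric.

(* N(X; chi), where T is the ambient set of geometric points and X the subset
   of those lying on the variety.  The cardinal of fset_set is the true one for
   finite sets (and 0 for infinite ones). *)
Definition twisted_count (T : choiceType) (G : finGroupType) (X : set T)
    (Frob : T -> T) (act : G -> T -> T) (chi : G -> algC) : algC :=
  #|G|%:R^-1 *
  \sum_(g : G)
    chi g * #|` fset_set (fun P : T => X P /\ Frob P = act g P) |%:R.

Section Variety.

Variables (F : finFieldType) (K : closedFieldType) (iota : {rmorphism F -> K}).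
Variables (m n : nat).

Local Notation l := (n - m)%N.
Local Notation N := (#|F|.-1).

(* Geometric points of affine space, in the coordinates (x, y, z, t). *)
Definition ambient : choiceType :=
  ({ffun 'I_m -> K} * {ffun 'I_m -> K} * {ffun 'I_l -> K} * {ffun 'I_l -> K})%type.

(* dffun, rather than ffun, carries the direct product group structure. *)
Definition symgroup : finGroupType :=
  ({dffun forall _ : 'I_m, {unit F}} * {dffun forall _ : 'I_m, {unit F}} *
   {dffun forall _ : 'I_l, {unit F}} * {dffun forall _ : 'I_l, F})%type.

Definition mXn (lambda : F) : set ambient := fun P =>
  let: (x, y, z, t) := P in
  [/\ forall i, x i ^+ N + y i ^+ N = 1,
      forall j, t j ^+ #|F| - t j = z j ^+ N,
      (-1) ^+ n * iota lambda * \prod_i x i ^+ N =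
        \prod_i y i ^+ N * \prod_j z j ^+ N &
      \prod_i (x i * y i) * \prod_j z j != 0].

Definition frob (P : ambient) : ambient :=
  let: (x, y, z, t) := P in
  ([ffun i => x i ^+ #|F|], [ffun i => y i ^+ #|F|],
   [ffun j => z j ^+ #|F|], [ffun j => t j ^+ #|F|]).

Definition symact (g : symgroup) (P : ambient) : ambient :=
  let: (xi, xi', zeta, a) := g in
  let: (x, y, z, t) := P in
  ([ffun i => iota (val (xi i)) * x i], [ffun i => iota (val (xi' i)) * y i],
   [ffun j => iota (val (zeta j)) * z j], [ffun j => t j + iota (a j)]).

Definition symchar (psi : addcfun F) (alpha beta : 'I_m -> mulcfun F)
    (gamma : 'I_l -> mulcfun F) (c : 'I_l -> F) (g : symgroup) : algC :=
  let: (xi, xi', zeta, a) := g in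
  \prod_i (alpha i (xi i) * beta i (xi' i)) *
  \prod_j (gamma j (zeta j) * psi (c j * a j)).

Lemma symact1 (P : ambient) : symact 1%g P = P.
Proof.
case: P => [[[x y] z] t].
by congr (_, _, _, _); apply/ffunP => i;
  rewrite !ffunE /= ?rmorph1 ?mul1r // rmorph0 addr0.
Qed.

Lemma symactM (g h : symgroup) (P : ambient) :
  symact (g * h)%g P = symact g (symact h P).
Proof.
case: P g h => [[[x y] z] t] [[[g1 g2] g3] g4] [[[h1 h2] h3] h4].
by congr (_, _, _, _); apply/ffunP => i;
  rewrite !ffunE /= ?rmorphM ?mulrA // rmorphD /= (addrC (iota _)) addrA.
Qed.

Lemma symcharM psi alpha beta gamma c (g h : symgroup) :
    psi \is a linear_char -> (forall i, alpha i \is a linear_char) ->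
    (forall i, beta i \is a linear_char) ->
    (forall j, gamma j \is a linear_char) ->
  symchar psi alpha beta gamma c (g * h)%g =
  symchar psi alpha beta gamma c g * symchar psi alpha beta gamma c h.
Proof.
move=> Lpsi Lal Lbe Lga.
case: g h => [[[g1 g2] g3] g4] [[[h1 h2] h3] h4].
rewrite /symchar /= mulrACA -!big_split /=; congr (_ * _); apply: eq_bigr => i _.
  by rewrite !ffunE !lin_charM ?inE // mulrACA.
by rewrite !ffunE mulrDr !lin_charM ?inE // mulrACA.
Qed.

Lemma symact_mXn (lambda : F) (g : symgroup) (P : ambient) :
  mXn lambda P -> mXn lambda (symact g P).
Proof.
case: P g => [[[x y] z] t] [[[g1 g2] g3] g4] [Hxy Ht Hl Hn].
have uN (u : {unit F}) (k : K) : (iota (val u) * k) ^+ N = k ^+ N.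
  rewrite exprMn -rmorphXn /= (_ : val u ^+ N = 1) ?rmorph1 ?mul1r //.
  have u0 : val u != 0 by rewrite -unitfE; apply: (valP u).
  apply: (mulfI u0); rewrite -exprS prednK ?mulr1 ?expf_card //.
  by apply/card_gt0P; exists 0.
split=> /=.
- by move=> i; rewrite !ffunE !uN.
- move=> j; rewrite !ffunE uN -Ht.
  have [p pr_p pcF] := finPcharP F.
  have pK : [pchar K].-nat #|F|.
    rewrite (eq_pnat _ (fmorph_pchar iota)) (eq_pnat _ (pcharf_eq pcF)).
    by rewrite (card_pprimeChar pcF : #|F| = _) pnatX pnat_id.
  by rewrite exprDn_pchar // -rmorphXn /= expf_card opprD addrACA subrr addr0.
- under eq_bigr do rewrite ffunE uN.
  by rewrite Hl; congr (_ * _); apply: eq_bigr => i _; rewrite !ffunE uN.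
- have i0 (u : {unit F}) : iota (val u) != 0.
    by rewrite fmorph_eq0 -unitfE; apply: (valP u).
  move: Hn; rewrite !mulf_eq0 !negb_or => /andP[/prodf_neq0 H1 /prodf_neq0 H2].
  apply/andP; split; apply/prodf_neq0 => i _; rewrite !ffunE.
    have := H1 i isT; rewrite !mulf_eq0 !negb_or => /andP[-> ->].
    by rewrite !i0.
  by rewrite mulf_neq0 ?i0 ?H2.
Qed.

End Variety.

Arguments symact {F K} iota {m n} g P.
Arguments frob F {K m n} P.
Arguments symchar {F m n} psi alpha beta gamma c g.

(* Main.v *)
Require Import Defs.
From HB Require Import structures.
From mathcomp Require Import all_boot all_order all_algebra all_fingroup.
From mathcomp Require Import all_solvable all_field all_character ring.
From mathcomp Require Import finmap boolp classical_sets cardinality.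
Import GRing.Theory.
Local Open Scope ring_scope.

(* A point P = (x, y, z, t) of the variety satisfies Frob P = g P, with
   g = (xi, xi', zeta, a), iff x_i^N = xi_i, y_i^N = xi'_i, z_j^N = zeta_j and
   t_j^q - t_j = a_j.  These Kummer and Artin-Schreier equations define a torsor
   under G, and the equations of the variety become equations on g alone:
   xi_i + xi'_i = 1, a_j = zeta_j and
   (-1)^n lambda prod xi_i = prod xi'_i prod zeta_j.  Hence N(X; chi) is the sum
   of chi(g) over the g satisfying them.  Detecting the last equation by
   orthogonality of the characters nu of F^*, the sum factors into Jacobi sums
   j(alpha_i nu, beta_i nu^-1) and Gauss sums g(gamma_j nu^-1), which the
   relations j(a, b) g(ab) = g(a) g(b), for ab nontrivial, and
   g(a) g°(a^-1) = q a(-1) express through Pochhammer symbols. *)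

(** * Units of a finite field and sums over them *)

Lemma unit_neq0 (F : finFieldType) (u : {unit F}) : val u != 0.
Proof. by rewrite -unitfE; apply: (valP u). Qed.

Lemma exists_unit (F : finFieldType) (x : F) :
  x != 0 -> exists u : {unit F}, val u = x.
Proof. by rewrite -unitfE => Ux; exists (FinRing.Unit Ux). Qed.

Lemma mulchar_extE (F : finFieldType) (eta : mulcfun F) (u : {unit F}) :
  mulchar_ext eta (val u) = eta u.
Proof. by rewrite /mulchar_ext valK. Qed.

Lemma sum_unit (F : finFieldType) (f : F -> algC) :
  \sum_(u : {unit F}) f (val u) = \sum_x f x - f 0.
Proof.
rewrite (bigD1 (0 : F)) //= addrAC subrr add0r.
(* The default [unit1] is reached only at 0, which the range of summation excludes. *)
pose h (x : F) : {unit F} := insubd (FinRing.unit1 F) x.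
rewrite (reindex_onto (fun u : {unit F} => val u) h) /=; last first.
  by move=> x x0; rewrite val_insubd unitfE x0.
apply: eq_bigl => u; rewrite unit_neq0 /=; apply/esym/eqP/val_inj.
by rewrite val_insubd (valP u).
Qed.

(** * Linear characters of a finite group and their orthogonality *)

Section LinearCharacters.

Variable gT : finGroupType.
Implicit Types xi eta : 'CF([set: gT]%G).

Lemma lin_charMT xi (x y : gT) :
  xi \is a linear_char -> xi (x * y)%g = xi x * xi y.
Proof. by move=> Lxi; rewrite lin_charM ?inE. Qed.

Lemma lin_charVT xi (x : gT) :
  xi \is a linear_char -> xi x^-1%g = (xi x)^-1.
Proof. by move=> Lxi; rewrite lin_charV ?inE. Qed.

Lemma lin_char_neq0T xi (x : gT) : xi \is a linear_char -> xi x != 0.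
Proof. by move=> Lxi; rewrite lin_char_neq0 ?inE. Qed.

Lemma lin_char_invE xi (x : gT) :
  xi \is a linear_char -> xi^-1 x = (xi x)^-1.
Proof.
move=> Lxi; rewrite invr_lin_char // cfunE -lin_charVT //.
by rewrite lin_charV_conj ?inE.
Qed.

(** A nontrivial [xi] has some [y] with [xi y != 1]; translation by [y] multiplies the sum by [xi y]
    yet leaves it unchanged, so it vanishes. *)
Lemma sum_lin_char xi : xi \is a linear_char ->
  \sum_x xi x = (#|gT| * (xi == 1))%:R.
Proof.
move=> Lxi; have [->|nt_xi] := eqVneq xi 1.
  under eq_bigr do rewrite cfun1E inE.
  by rewrite sumr_const muln1.
have [y y_nt] : exists y, xi y != 1.
  apply/existsP; apply: contraNT nt_xi => /existsPn xi1.
  apply/eqP/cfunP => y; rewrite cfun1E inE.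
  by apply/eqP; move: (xi1 y); rewrite negbK.
rewrite muln0; apply/eqP; have: (xi y - 1) * (\sum_x xi x) = 0.
  rewrite mulrBl mul1r mulr_sumr [X in _ - X](reindex_inj (mulgI y)) /=.
  by apply/eqP; rewrite subr_eq0; apply/eqP/eq_bigr => x _; rewrite lin_charMT.
by move/eqP; rewrite mulf_eq0 subr_eq0 (negPf y_nt).
Qed.

End LinearCharacters.

(** * Gauss and Jacobi sums, and their behaviour under twisting by [nu] *)

Section GaussSums.

Variables (F : finFieldType) (psi : addcfun F).
Hypotheses (psi_char : psi \is a linear_char) (psi_nontriv : psi != 1).
Implicit Types eta : mulcfun F.
Local Notation q := (#|F|%:R : algC).

Lemma card_unit_field : #|{: {unit F}}| = #|F|.-1.
Proof. by rewrite -card_finField_unit cardsT. Qed.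

Lemma card_field_gt0 : (0 < #|F|)%N.
Proof. by apply/card_gt0P; exists 0. Qed.

Lemma card_unit_fieldR : #|{: {unit F}}|%:R = q - 1.
Proof. by rewrite card_unit_field -subn1 natrB ?card_field_gt0. Qed.

(** The regular character is the sum of all irreducible ones weighted by their degrees, here all 1,
    and it is supported at the identity. *)
Lemma sum_mulchar (u : {unit F}) :
  \sum_(i : Iirr [set: {unit F}]%G) 'chi_i u = (q - 1) * (u == 1%g)%:R.
Proof.
have := cfRegE [set: {unit F}]%G u.
rewrite cfReg_sum sum_cfunE cardsT card_unit_fieldR mulr_natr => <-.
by apply: eq_bigr => i _; rewrite cfunE lin_char1 ?mul1r // mulchar_irr_lin.
Qed.

Lemma addchar_add (x y : F) : psi (x + y) = psi x * psi y.
Proof. exact: (lin_charMT _ psi). Qed.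

Lemma addchar0 : psi 0 = 1.
Proof. exact: (lin_char1 psi_char). Qed.

(** The [- 1] removes the term at 0 from the sum over all of [F]. *)
Lemma sum_unit_addchar (a : F) :
  \sum_(u : {unit F}) psi (a * val u) = q * (a == 0)%:R - 1.
Proof.
rewrite (sum_unit _ (fun x => psi (a * x))) mulr0 addchar0; congr (_ - _).
have [->|a0] := eqVneq a 0.
  under eq_bigr do rewrite mul0r addchar0.
  by rewrite sumr_const mulr1.
transitivity (\sum_x psi x); first by rewrite [RHS](reindex_inj (mulfI a0)).
by rewrite mulr0 (sum_lin_char _ psi) // (negPf psi_nontriv) muln0.
Qed.

Definition unitN1 : {unit F} := FinRing.Unit (unitrN1 F).

Lemma mulchar_unitN1_sqr eta :
  eta \is a linear_char -> eta unitN1 * eta unitN1 = 1.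
Proof.
move=> Leta; rewrite -lin_charMT // -[RHS](lin_char1 Leta); congr (eta _).
by apply/val_inj; rewrite FinRing.val_unitM /= mulrNN mulr1.
Qed.

(** Substituting x = w y in the double sum leaves the sum over w and y of eta(w) psi((w + 1) y). The
    inner sum over y is -1, plus q when w = -1. *)
Lemma gauss_mulV eta : eta \is a linear_char ->
  gauss psi eta * gauss psi eta^-1 =
    q * eta unitN1 - (#|{: {unit F}}| * (eta == 1))%:R.
Proof.
move=> Leta; rewrite /gauss mulrNN mulr_suml.
under eq_bigr do rewrite mulr_sumr.
rewrite exchange_big /=.
under eq_bigr => y _.
  rewrite (reindex_inj (mulIg y)) /=.
  under eq_bigr => w _.
    rewrite lin_charMT // lin_char_invE // mulrACA mulfK ?lin_char_neq0T //.
    rewrite -addchar_add.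
    have -> : \val (w * y)%g + \val y = (\val w + 1) * \val y.
      by rewrite FinRing.val_unitM mulrDl mul1r.
    over.
  over.
rewrite exchange_big /=.
under eq_bigr do rewrite -mulr_suml sum_unit_addchar mulrBl mul1r.
rewrite sumrB sum_lin_char //; congr (_ - _).
rewrite (bigD1 unitN1) //= addNr eqxx mulr1 big1 ?addr0 // => w ne_w.
rewrite addr_eq0 (_ : (\val w == -1) = false) ?mulr0 ?mul0r //.
by apply: contraNF ne_w => /eqP w1; apply/eqP/val_inj.
Qed.

Lemma gauss1 : gauss psi 1 = 1.
Proof.
rewrite /gauss.
under eq_bigr do rewrite cfun1E inE mulr1 -[\val _]mul1r.
by rewrite sum_unit_addchar oner_eq0 mulr0 sub0r opprK.
Qed.

(** The extra factor q in [gausso] at the trivial character is what makes this reflection formula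
    uniform: [gauss_mulV] alone gives 1 there instead of q. *)
Lemma gauss_gausso eta : eta \is a linear_char ->
  gauss psi eta * gausso psi eta^-1 = q * eta unitN1.
Proof.
move=> Leta; rewrite /gausso mulrCA.
have [->|nt_eta] := eqVneq eta 1.
  by rewrite invr1 eqxx gauss1 !mulr1 cfun1E inE mulr1.
by rewrite invr_eq1 (negPf nt_eta) mul1r gauss_mulV // (negPf nt_eta) muln0 subr0.
Qed.

(** A vanishing Gauss sum would contradict the reflection formula, whose right side is nonzero. *)
Lemma gauss_neq0 eta : eta \is a linear_char -> gauss psi eta != 0.
Proof.
move=> Leta; have := gauss_gausso _ Leta; apply: contra_eq_neq => ->.
rewrite mul0r eq_sym mulf_neq0 ?lin_char_neq0T //.
by rewrite Num.Theory.pnatr_eq0 -lt0n card_field_gt0.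
Qed.

Lemma gausso_neq0 eta : eta \is a linear_char -> gausso psi eta != 0.
Proof.
move=> Leta; rewrite mulf_neq0 ?gauss_neq0 // expf_neq0 //.
by rewrite Num.Theory.pnatr_eq0 -lt0n card_field_gt0.
Qed.

(* Collect the pairs (x, y) by s = x + y: the pairs with s = 0 contribute
   beta(-1) times the sum of alpha * beta, which vanishes, and the substitution
   (x, y) -> (s x, s y) turns each fibre s != 0 into the Jacobi sum. *)
Lemma gauss_jacobi (alpha beta : mulcfun F) :
    alpha \is a linear_char -> beta \is a linear_char -> alpha * beta != 1 ->
  gauss psi alpha * gauss psi beta =
    jacobi alpha beta * gauss psi (alpha * beta).
Proof.
move=> La Lb nt; rewrite /gauss /jacobi !mulrNN.
pose f (x y : {unit F}) := psi (val x + val y) * (alpha x * beta y).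
transitivity (\sum_x \sum_y f x y).
  rewrite mulr_suml; apply: eq_bigr => x _; rewrite mulr_sumr; apply: eq_bigr => y _.
  by rewrite mulrACA -addchar_add.
transitivity (\sum_(s : {unit F}) \sum_x \sum_(y | val x + val y == val s :> F) f x y).
  rewrite [RHS]exchange_big /=.
  under [RHS]eq_bigr => x _.
    rewrite (exchange_big_dep xpredT) //=.
    over.
  transitivity (\sum_x \sum_y f x y * (val x + val y != 0 :> F)%:R); last first.
    apply: eq_bigr => x _; apply: eq_bigr => y _.
    have [xy0|] := eqVneq (val x + val y : F) 0.
      rewrite mulr0 big1 // => s /eqP xys.
      by move: (unit_neq0 _ s); rewrite /= -xys xy0 eqxx.
    case/exists_unit=> s def_s; rewrite mulr1 (big_pred1 s) // => s'.
    by rewrite -def_s (inj_eq val_inj) eq_sym.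
  apply/eqP; rewrite -subr_eq0 -sumrB.
  under eq_bigr => x _.
    rewrite -sumrB (bigD1 (unitN1 * x)%g) //= big1 ?addr0; last first.
      move=> y ney; rewrite addr_eq0 (_ : (_ == _) = false) ?mulr1 ?subrr //.
      apply: contraNF ney => /eqP xy; apply/eqP/val_inj.
      by rewrite FinRing.val_unitM /= xy mulN1r opprK.
    rewrite /f FinRing.val_unitM /= mulN1r subrr eqxx mulr0 subr0.
    rewrite addchar0 mul1r lin_charMT // mulrCA.
    have -> : alpha x * beta x = (alpha * beta) x by rewrite cfunE.
    over.
  by rewrite -mulr_sumr sum_lin_char ?rpredM // (negPf nt) muln0 mulr0.
rewrite mulr_sumr; apply: eq_bigr => s _; rewrite mulr_suml.
rewrite (reindex_inj (mulgI s)) /=; apply: eq_bigr => x _.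
rewrite mulr_suml (reindex_inj (mulgI s)) /=; apply: eq_big => [y|y /eqP sxy].
  rewrite -[X in _ == X]mulr1.
  rewrite -[X in X == _]/(\val s * \val x + \val s * \val y) -mulrDr.
  by rewrite (inj_eq (mulfI (unit_neq0 _ s))).
by rewrite /f sxy cfunE !lin_charMT //; ring.
Qed.

(** Rescaling the summation variable by [c] trades the additive twist for a value of [eta^-1]. *)
Lemma sum_unit_gauss eta (c : F) : eta \is a linear_char -> c != 0 ->
  \sum_(u : {unit F}) psi (c * val u) * eta u =
    - (gauss psi eta * mulchar_ext eta^-1 c).
Proof.
move=> Leta /exists_unit[d <-]; rewrite mulchar_extE lin_char_invE //.
rewrite mulNr opprK mulr_suml [RHS](reindex_inj (mulgI d)) /=.
apply: eq_bigr => u _; rewrite lin_charMT // -mulrA; congr (_ * _).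
by rewrite mulrC mulKf ?lin_char_neq0T.
Qed.

(** Two reflection formulas are compared, one for [eta * nu^-1] and one for [eta]: their right sides
    differ by nu(-1), which is its own inverse. *)
Lemma gauss_twist eta nu : eta \is a linear_char -> nu \is a linear_char ->
  gauss psi (eta * nu^-1) =
    gauss psi eta * nu unitN1 / pocho psi eta^-1 nu.
Proof.
move=> Leta Lnu; have Lnu' : nu^-1 \is a linear_char by rewrite rpredV.
have Leta' : eta^-1 \is a linear_char by rewrite rpredV.
have Len : eta * nu^-1 \is a linear_char by rewrite rpredM.
have Len' : eta^-1 * nu \is a linear_char by rewrite rpredM.
apply: (mulIf (gausso_neq0 _ Len')).
have -> : gauss psi (eta * nu^-1) * gausso psi (eta^-1 * nu) = q * (eta * nu^-1) unitN1.
  rewrite -gauss_gausso //; congr (_ * gausso psi _).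
  by rewrite invrM ?lin_char_unitr // invrK mulrC.
rewrite /pocho invf_div -!mulrA mulVf ?gausso_neq0 // mulr1.
rewrite mulrCA gauss_gausso // cfunE lin_char_invE //.
have -> : (nu unitN1)^-1 = nu unitN1.
  apply: (mulIf (lin_char_neq0T _ _ unitN1 Lnu)).
  by rewrite mulchar_unitN1_sqr // mulVf ?lin_char_neq0T.
by ring.
Qed.

(** The twist does not change the product [alpha * beta], so both Jacobi sums are quotients of Gauss
    sums with the same denominator. *)
Lemma jacobi_twist (alpha beta nu : mulcfun F) :
    alpha \is a linear_char -> beta \is a linear_char -> nu \is a linear_char ->
    alpha * beta != 1 ->
  jacobi (alpha * nu) (beta * nu^-1) =
    jacobi alpha beta * poch psi alpha nu * nu unitN1 / pocho psi beta^-1 nu.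
Proof.
move=> La Lb Lnu nt; have Lnu' : nu^-1 \is a linear_char by rewrite rpredV.
have Ean : alpha * nu * (beta * nu^-1) = alpha * beta.
  by rewrite mulrACA divrr ?mulr1 ?lin_char_unitr.
apply: (mulIf (gauss_neq0 _ (rpredM La Lb))).
rewrite -{1}Ean -gauss_jacobi ?rpredM ?Ean // gauss_twist //.
have -> : jacobi alpha beta = gauss psi alpha * gauss psi beta / gauss psi (alpha * beta).
  by rewrite gauss_jacobi // mulfK ?gauss_neq0 ?rpredM.
rewrite /poch /pocho; field.
by rewrite ?gauss_neq0 ?gausso_neq0 ?rpredM ?rpredV.
Qed.
End GaussSums.

(** * Kummer and Artin-Schreier fibres, and the count of twisted Frobenius fixed points *)

Section FixedPoints.

Variables (F : finFieldType) (K : closedFieldType) (iota : {rmorphism F -> K}).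
Variables (m n : nat).

Local Notation l := (n - m)%N.
Local Notation q := #|F|.
Local Notation N := (#|F|.-1).
Local Notation G := (symgroup F m n).
Local Notation A := (ambient K m n).

Lemma prednK_card : N.+1 = q.
Proof. by rewrite prednK ?card_field_gt0. Qed.

Lemma iota_unit_neq0 (u : {unit F}) : iota (val u) != 0.
Proof. by rewrite fmorph_eq0 unit_neq0. Qed.

(** The polynomial X^q - X is the product of the X - a over [F]; evaluating its image under [iota]
    at [w] makes one factor vanish. *)
Lemma frob_fixed_range (w : K) : w ^+ q = w -> exists a : F, w = iota a.
Proof.
move=> wq; have := congr1 (fun p => (map_poly iota p).[w]) (finField_genPoly F).
rewrite rmorphB /= map_polyXn map_polyX rmorph_prod /= horner_prod !hornerE wq subrr.
move=> /esym/eqP/prodf_eq0[a _].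
by rewrite rmorphB /= map_polyX map_polyC /= !hornerE subr_eq0 => /eqP->; exists a.
Qed.

Lemma kummer_range (w : K) : w ^+ N = 1 -> exists u : {unit F}, w = iota (val u).
Proof.
move=> wN; have [|a def_w] := frob_fixed_range w.
  by rewrite -prednK_card exprS wN mulr1.
have [|u def_a] := @exists_unit F a; last by exists u; rewrite def_a.
rewrite -(fmorph_eq0 iota) -def_w; apply/eqP=> w0.
by move/eqP: wN; rewrite w0 expr0n -subn1 subn_eq0 leqNgt finNzRing_gt1 eq_sym oner_eq0.
Qed.

Lemma card_field_pred_gt0 : (0 < N)%N.
Proof. by rewrite -subn1 subn_gt0 finNzRing_gt1. Qed.

Lemma kummer_solvable (a : K) : exists x : K, x ^+ N = a.
Proof.
have [x Hx] := solve_monicpoly (fun i => if i is 0 then a else 0) card_field_pred_gt0.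
exists x; rewrite Hx; case: (N) card_field_pred_gt0 => // k _.
by rewrite big_ord_recl big1 ?addr0 ?mulr1 // => i _; rewrite mul0r.
Qed.

Lemma artin_schreier_solvable (a : K) : exists t : K, t ^+ q - t = a.
Proof.
have [x Hx] := solve_monicpoly (fun i => if i is i'.+1 then
  if i' is 0 then 1 else 0 else a) (card_field_gt0 F).
(* Since q is at least 2, the linear coefficient lies strictly below the leading term of the monic
   equation. *)
exists x; rewrite {1}Hx; case: (q) (finNzRing_gt1 F) => // -[|k] // _.
rewrite !big_ord_recl big1 ?addr0 /= => [|i _]; last by rewrite mul0r.
by rewrite mulr1 mul1r addrK.
Qed.

Definition fibre_eqs (g : G) (P : A) : Prop :=
  let: (xi, xi', zeta, a) := g in
  let: (x, y, z, t) := P in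
  [/\ forall i, x i ^+ N = iota (val (xi i)),
      forall i, y i ^+ N = iota (val (xi' i)),
      forall j, z j ^+ N = iota (val (zeta j)) &
      forall j, t j ^+ q - t j = iota (a j)].

(** These are the equations of the variety read on [g]; being boolean, they serve as a 0/1 weight in
    the count. *)
Definition base_eqs (lambda : F) (g : G) : bool :=
  let: (xi, xi', zeta, a) := g in
  [&& [forall i, val (xi i) + val (xi' i) == 1 :> F],
      [forall j, a j == val (zeta j)] &
      (-1) ^+ n * lambda * \prod_i val (xi i) ==
      \prod_i val (xi' i) * \prod_j val (zeta j)].

Lemma frob_coord (x : K) (u : {unit F}) : x != 0 ->
  x ^+ q = iota (val u) * x <-> x ^+ N = iota (val u).
Proof.
move=> x0; rewrite -prednK_card exprSr; split=> [|-> //].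
by move/(mulIf x0).
Qed.

Lemma kummer_neq0 (x : K) (u : {unit F}) : x ^+ N = iota (val u) -> x != 0.
Proof.
move=> xN; apply: contraTneq (iota_unit_neq0 u) => x0.
by rewrite -xN x0 expr0n eqn0Ngt card_field_pred_gt0 eqxx.
Qed.

(** The nonvanishing condition of the variety lets x cancel in x^q = xi x. Conversely it is
    automatic, because the N-th powers of x, y and z are images of units. The remaining equations
    pass between [F] and [K] by injectivity of [iota]. *)
Lemma frob_fixedP (lambda : F) (g : G) (P : A) :
  mXn iota lambda P /\ frob F P = symact iota g P <->
  fibre_eqs g P /\ base_eqs lambda g.
Proof.
case: g P => [[[xi xi'] zeta] a] [[[x y] z] t]; split.
  case=> -[Hxy Ht Hl Hn] [/ffunP Ex /ffunP Ey /ffunP Ez /ffunP Et].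
  move: Hn; rewrite mulf_eq0 negb_or => /andP[/prodf_neq0 H1 /prodf_neq0 H2].
  have x0 i : x i != 0 by have := H1 i isT; rewrite mulf_eq0 negb_or => /andP[].
  have y0 i : y i != 0 by have := H1 i isT; rewrite mulf_eq0 negb_or => /andP[].
  have z0 j : z j != 0 by exact: H2.
  have xN i : x i ^+ N = iota (val (xi i)).
    by apply/frob_coord => //; move: (Ex i); rewrite !ffunE.
  have yN i : y i ^+ N = iota (val (xi' i)).
    by apply/frob_coord => //; move: (Ey i); rewrite !ffunE.
  have zN j : z j ^+ N = iota (val (zeta j)).
    by apply/frob_coord => //; move: (Ez j); rewrite !ffunE.
  have tq j : t j ^+ q - t j = iota (a j).
    by move: (Et j); rewrite !ffunE => ->; rewrite addrC addKr.
  split=> //; apply/and3P; split.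
  - apply/forallP => i; apply/eqP/(fmorph_inj iota).
    by rewrite rmorphD /= rmorph1 -xN -yN.
  - by apply/forallP => j; apply/eqP/(fmorph_inj iota); rewrite -tq -zN.
  - apply/eqP/(fmorph_inj iota); rewrite !rmorphM rmorphXn rmorphN1 !rmorph_prod /=.
    under eq_bigr do rewrite -xN.
    by rewrite Hl; congr (_ * _); apply: eq_bigr => i _.
case=> -[xN yN zN tq] /and3P[/forallP Hxy /forallP Ha /eqP Hl].
have x0 i := kummer_neq0 _ _ (xN i); have y0 i := kummer_neq0 _ _ (yN i).
have z0 j := kummer_neq0 _ _ (zN j).
split; first split.
- by move=> i; rewrite xN yN -rmorphD /= (eqP (Hxy i)) rmorph1.
- by move=> j; rewrite tq zN (eqP (Ha j)).
- under eq_bigr do rewrite xN.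
  under [X in _ = X * _]eq_bigr do rewrite yN.
  under [X in _ = _ * X]eq_bigr do rewrite zN.
  by rewrite -!rmorph_prod -rmorphM /= -Hl !rmorphM rmorphXn rmorphN1.
- by rewrite mulf_neq0 //; apply/prodf_neq0 => i _; rewrite ?mulf_neq0.
congr (_, _, _, _); apply/ffunP => i; rewrite !ffunE.
- exact/frob_coord.
- exact/frob_coord.
- exact/frob_coord.
- by rewrite -tq addrC subrK.
Qed.

Lemma fibre_nonempty (g : G) : exists P, fibre_eqs g P.
Proof.
case: g => [[[xi xi'] zeta] a].
have [x Hx] := fin_all_exists (fun i => kummer_solvable (iota (val (xi i)))).
have [y Hy] := fin_all_exists (fun i => kummer_solvable (iota (val (xi' i)))).
have [z Hz] := fin_all_exists (fun i => kummer_solvable (iota (val (zeta i)))).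
have [t Ht] := fin_all_exists (fun i => artin_schreier_solvable (iota (a i))).
exists (finfun x, finfun y, finfun z, finfun t).
by split=> i; rewrite !ffunE.
Qed.

(** This makes the q-th power map on [K] additive. *)
Lemma card_pchar_nat : [pchar K].-nat q.
Proof.
have [p pr_p pcF] := finPcharP F.
rewrite (eq_pnat _ (fmorph_pchar iota)) (eq_pnat _ (pcharf_eq pcF)).
by rewrite (card_pprimeChar pcF : q = _) pnatX pnat_id.
Qed.

Lemma unit_expN (u : {unit F}) : iota (val u) ^+ N = 1.
Proof.
apply: (mulfI (iota_unit_neq0 u)).
by rewrite -exprS prednK_card -rmorphXn /= expf_card mulr1.
Qed.

Lemma kummer_torsor (x x0 : K) (u : {unit F}) :
    x0 ^+ N = iota (val u) -> x ^+ N = iota (val u) ->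
  exists v : {unit F}, x = iota (val v) * x0.
Proof.
move=> x0N xN; have nz := kummer_neq0 _ _ x0N.
have [|v def_v] := kummer_range (x / x0).
  by rewrite expr_div_n x0N xN divff ?iota_unit_neq0.
by exists v; rewrite -def_v divfK.
Qed.

Lemma artin_schreier_torsor (t t0 b : K) :
    t0 ^+ q - t0 = b -> t ^+ q - t = b -> exists a : F, t = t0 + iota a.
Proof.
move=> t0q tq; have [|a def_a] := frob_fixed_range (t - t0).
  rewrite exprDn_pchar ?card_pchar_nat //.
  (* Additivity of the q-th power applied to t0 - t0 gives the sign without a case distinction on
     the parity of q. *)
  have -> : (- t0) ^+ q = - t0 ^+ q.
    have: (t0 - t0) ^+ q = 0 by rewrite subrr expr0n eqn0Ngt card_field_gt0.
    by rewrite exprDn_pchar ?card_pchar_nat // => /eqP; rewrite addrC addr_eq0 => /eqP.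
  have -> : t ^+ q = t + b by rewrite -tq addrC subrK.
  have -> : t0 ^+ q = t0 + b by rewrite -t0q addrC subrK.
  by ring.
by exists a; rewrite -def_a addrC subrK.
Qed.

(** Two solutions of a Kummer equation differ by an N-th root of unity and two solutions of an
    Artin-Schreier equation by an element of [F], so each fibre is a single orbit of [G]. *)
Lemma fibre_torsor (g : G) (P0 P : A) : fibre_eqs g P0 ->
  fibre_eqs g P <-> exists h, P = symact iota h P0.
Proof.
case: g P0 P => [[[xi xi'] zeta] a] [[[x0 y0] z0] t0] [[[x y] z] t].
case=> x0N y0N z0N t0q; split=> [[xN yN zN tq]|].
  have [h1 E1] := fin_all_exists (fun i => kummer_torsor _ _ _ (x0N i) (xN i)).
  have [h2 E2] := fin_all_exists (fun i => kummer_torsor _ _ _ (y0N i) (yN i)).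
  have [h3 E3] := fin_all_exists (fun i => kummer_torsor _ _ _ (z0N i) (zN i)).
  have [h4 E4] := fin_all_exists (fun i => artin_schreier_torsor _ _ _ (t0q i) (tq i)).
  exists (finfun h1 : {dffun _}, finfun h2 : {dffun _}, finfun h3 : {dffun _},
          finfun h4 : {dffun _}).
  by congr (_, _, _, _); apply/ffunP => i; rewrite !ffunE.
case=> -[[[h1 h2] h3] h4] [-> -> -> ->]; split=> i; rewrite !ffunE.
- by rewrite exprMn unit_expN mul1r.
- by rewrite exprMn unit_expN mul1r.
- by rewrite exprMn unit_expN mul1r.
- rewrite exprDn_pchar ?card_pchar_nat // -rmorphXn /= expf_card.
  by rewrite opprD addrACA subrr addr0.
Qed.

Lemma symact_free (g : G) (P : A) : fibre_eqs g P ->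
  injective (fun h : G => symact iota h P).
Proof.
case: g P => [[[xi xi'] zeta] a] [[[x y] z] t] [xN yN zN _].
move=> [[[h1 h2] h3] h4] [[[k1 k2] k3] k4].
case=> /ffunP E1 /ffunP E2 /ffunP E3 /ffunP E4.
congr (_, _, _, _); apply/ffunP => i.
- have := E1 i; rewrite !ffunE => /(mulIf (kummer_neq0 _ _ (xN i))).
  by move/fmorph_inj/val_inj.
- have := E2 i; rewrite !ffunE => /(mulIf (kummer_neq0 _ _ (yN i))).
  by move/fmorph_inj/val_inj.
- have := E3 i; rewrite !ffunE => /(mulIf (kummer_neq0 _ _ (zN i))).
  by move/fmorph_inj/val_inj.
- by have := E4 i; rewrite !ffunE => /addrI/fmorph_inj.
Qed.

(** When [g] satisfies the base equations, the set is a whole fibre, that is, a free orbit of [G];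
    otherwise it is empty. *)
Lemma card_frob_fixed (lambda : F) (g : G) :
  #|` fset_set (fun P : A => mXn iota lambda P /\ frob F P = symact iota g P)|
    = (#|G| * base_eqs lambda g)%N.
Proof.
have [P0 P0g] := fibre_nonempty g.
have [bg|nbg] := boolP (base_eqs lambda g); last first.
  rewrite muln0 (_ : (fun P => _) = set0%classic) ?fset_set0 ?cardfs0 //.
  by apply/seteqP; split=> // P /frob_fixedP[_]; rewrite (negPf nbg).
rewrite muln1 (_ : (fun P => _) =
  [set` [fset symact iota h P0 | h in G]%fset]%classic); last first.
  apply/seteqP; split=> P /=.
    case/frob_fixedP => /(fibre_torsor _ _ _ P0g)[h ->] _.
    by apply/imfsetP; exists h.
  case/imfsetP => h _ ->; apply/frob_fixedP; split=> //.
  by apply/(fibre_torsor _ _ _ P0g); exists h.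
rewrite set_fsetK card_imfset /=; last exact: (symact_free g).
by rewrite cardE.
Qed.

Lemma twisted_count_base (lambda : F) (chi : G -> algC) :
  twisted_count (mXn iota lambda) (frob F) (symact iota) chi =
  \sum_(g : G) chi g * (base_eqs lambda g)%:R.
Proof.
rewrite /twisted_count mulr_sumr; apply: eq_bigr => g _.
rewrite card_frob_fixed natrM mulrCA mulKf //.
by rewrite Num.Theory.pnatr_eq0 -lt0n; apply/card_gt0P; exists 1%g.
Qed.

End FixedPoints.

(** * Expansion of the sum over the symmetry group into products over coordinates *)

Lemma prod_natr_bool (I : finType) (b : pred I) :
  \prod_i (b i)%:R = ([forall i, b i])%:R :> algC.
Proof.
have [/forallP b1|/forallPn[i nbi]] := boolP [forall i, b i].
  by rewrite big1 // => i _; rewrite b1.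
by rewrite (bigD1 i) //= (negPf nbi) mul0r.
Qed.

Lemma val_unit_prod (F : finFieldType) (I : finType) (u : I -> {unit F}) :
  val (\prod_i u i)%g = \prod_i val (u i).
Proof. exact: (big_morph (fun v : {unit F} => val v)). Qed.

Lemma mulchar_ext1 (F : finFieldType) (nu : mulcfun F) :
  nu \is a linear_char -> mulchar_ext nu 1 = 1.
Proof. by move=> Lnu; rewrite (mulchar_extE _ nu 1%g) lin_char1. Qed.

Lemma mulchar_ext0 (F : finFieldType) (nu : mulcfun F) : mulchar_ext nu 0 = 0.
Proof. by rewrite /mulchar_ext insubN ?unitr0. Qed.

Lemma mulchar_extM (F : finFieldType) (nu : mulcfun F) (x y : F) :
  nu \is a linear_char ->
  mulchar_ext nu (x * y) = mulchar_ext nu x * mulchar_ext nu y.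
Proof.
move=> Lnu; have [->|/exists_unit[u <-]] := eqVneq x 0.
  by rewrite mul0r mulchar_ext0 mul0r.
have [->|/exists_unit[v <-]] := eqVneq y 0.
  by rewrite mulr0 mulchar_ext0 mulr0.
by rewrite -FinRing.val_unitM !mulchar_extE lin_charMT.
Qed.

Lemma mulchar_ext_prod (F : finFieldType) (I : finType) (nu : mulcfun F)
    (x : I -> F) : nu \is a linear_char ->
  mulchar_ext nu (\prod_i x i) = \prod_i mulchar_ext nu (x i).
Proof.
move=> Lnu; apply: (big_morph (mulchar_ext nu)); last exact: mulchar_ext1.
by move=> y z; apply: mulchar_extM.
Qed.

Section Expansion.

Variables (F : finFieldType) (m n : nat).
Local Notation l := (n - m)%N.
Local Notation G := (symgroup F m n).

Lemma sum_symgroup_prod (f : 'I_m -> {unit F} -> {unit F} -> algC)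
    (h : 'I_l -> {unit F} -> F -> algC) :
  \sum_(g : G) (let: (xi, xi', zeta, a) := g in
     \prod_i f i (xi i) (xi' i) * \prod_j h j (zeta j) (a j)) =
  (\prod_i \sum_u \sum_v f i u v) * (\prod_j \sum_u \sum_x h j u x).
Proof.
transitivity (\sum_(xi : {ffun 'I_m -> {unit F}}) \sum_(xi' : {ffun 'I_m -> {unit F}})
    \sum_(zeta : {ffun 'I_l -> {unit F}}) \sum_(a : {ffun 'I_l -> F})
     \prod_i f i (xi i) (xi' i) * \prod_j h j (zeta j) (a j)).
  rewrite !pair_bigA /=.
  by apply: eq_bigr => -[[[xi xi'] zeta] a] _.
rewrite bigA_distr_bigA mulr_suml; apply: eq_bigr => xi _.
rewrite bigA_distr_bigA mulr_suml; apply: eq_bigr => xi' _.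
rewrite bigA_distr_bigA mulr_sumr; apply: eq_bigr => zeta _.
by rewrite bigA_distr_bigA mulr_sumr.
Qed.

Lemma base_eqs_natr (lam : {unit F}) (xi xi' : {dffun forall _ : 'I_m, {unit F}})
    (zeta : {dffun forall _ : 'I_l, {unit F}}) (a : {dffun forall _ : 'I_l, F}) :
  (base_eqs F m n (val lam) (xi, xi', zeta, a))%:R =
  (#|F|%:R - 1)^-1 * \sum_(i : Iirr [set: {unit F}]%G)
    'chi_i (unitN1 F) ^+ n * 'chi_i lam *
    (\prod_k ((val (xi k) + val (xi' k) == 1 :> F)%:R *
              ('chi_i (xi k) * ('chi_i)^-1 (xi' k))) *
     \prod_k ((a k == val (zeta k))%:R * ('chi_i)^-1 (zeta k))) :> algC.
Proof.
(* [w] is the quotient of the two sides of the last base equation, which thus reads w = 1 and is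
   detected by [sum_mulchar]. *)
pose w := (unitN1 F ^+ n * lam * (\prod_k xi k) *
           (\prod_k xi' k * \prod_k zeta k)^-1)%g.
rewrite /base_eqs.
have -> : ((-1) ^+ n * val lam * (\prod_i val (xi i)) ==
           (\prod_i val (xi' i)) * \prod_j val (zeta j)) = (w == 1%g).
  rewrite -!val_unit_prod -[X in _ == X]FinRing.val_unitM -eq_mulgV1.
  by rewrite -(inj_eq val_inj) !FinRing.val_unitM FinRing.val_unitX.
have q1 : (#|F|%:R - 1 : algC) != 0.
  rewrite -card_unit_fieldR Num.Theory.pnatr_eq0 -lt0n.
  by apply/card_gt0P; exists 1%g.
rewrite -!mulnb !natrM -[(w == 1%g)%:R](mulKf q1) -sum_mulchar.
rewrite mulrA mulrCA; congr (_ * _); rewrite mulr_sumr; apply: eq_bigr => i _.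
have Li := mulchar_irr_lin i.
rewrite !big_split /= !prod_natr_bool.
have -> : 'chi_i w = 'chi_i (unitN1 F) ^+ n * 'chi_i lam *
  (\prod_k 'chi_i (xi k) * (\prod_k ('chi_i)^-1 (xi' k) * \prod_k ('chi_i)^-1 (zeta k))).
  rewrite /w !lin_charMT // lin_charVT // lin_charMT // lin_charX ?inE //.
  rewrite !lin_char_prod ?inE // => *; rewrite ?inE //.
  rewrite -!mulrA; congr (_ * (_ * (_ * _))); rewrite invfM -!prodfV.
  by congr (_ * _); apply: eq_bigr => k _; rewrite lin_char_invE.
by ring.
Qed.

End Expansion.

Lemma prod_map_enum (I : finType) (T : Type) (f : I -> T) (h : T -> algC) :
  \prod_(x <- [seq f i | i <- enum I]) h x = \prod_i h (f i).
Proof. by rewrite big_image /=; apply: eq_bigl. Qed.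

(** * The character sum formula *)

Theorem theorem4p5
    (F : finFieldType)
    (K : closedFieldType) (iota : {rmorphism F -> K})
    (K_algebraic : integralRange iota)
    (psi : addcfun F) (psi_char : psi \is a linear_char) (psi_nontriv : psi != 1)
    (m n : nat) (le_mn : (m <= n)%N)
    (lambda : F) (lambda_neq0 : lambda != 0)
    (alpha beta : 'I_m -> mulcfun F) (gamma : 'I_(n - m) -> mulcfun F)
    (c : 'I_(n - m) -> F)
    (alpha_char : forall i, alpha i \is a linear_char)
    (beta_char : forall i, beta i \is a linear_char)
    (gamma_char : forall j, gamma j \is a linear_char)
    (c_neq0 : forall j, c j != 0)
    (alphabeta_nontriv : forall i, alpha i * beta i != 1) :
  twisted_count (mXn iota lambda) (frob F) (symact iota)
    (symchar psi alpha beta gamma c) =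
  (-1) ^+ n.+1 *
  (\prod_j (gauss psi (gamma j) * mulchar_ext (gamma j)^-1 (c j)) *
   \prod_i jacobi (alpha i) (beta i)) *
  hypergeom psi
    [seq alpha i | i <- enum 'I_m]
    ([seq (beta i)^-1 | i <- enum 'I_m] ++
     [seq (gamma j)^-1 | j <- enum 'I_(n - m)])
    ((\prod_j c j) * lambda).
Proof.
have [lam def_lam] := @exists_unit F lambda lambda_neq0.
rewrite twisted_count_base -def_lam.
(* Contribution of [nu] once the sums over [g] and [nu] are exchanged; the boolean factors encode
   the first two base equations, coordinate by coordinate. *)
pose term (nu : mulcfun F) := nu (unitN1 F) ^+ n * nu lam *
  ((\prod_i \sum_u \sum_v (val u + val v == 1 :> F)%:R *
      ((alpha i * nu) u * (beta i * nu^-1) v)) *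
   (\prod_j \sum_u \sum_x (x == val u)%:R *
      (psi (c j * x) * (gamma j * nu^-1) u))).
transitivity ((#|F|%:R - 1)^-1 *
    \sum_(i : Iirr [set: {unit F}]%G) term 'chi_i).
  rewrite mulr_sumr /term.
  under [RHS]eq_bigr do rewrite -sum_symgroup_prod !mulr_sumr.
  rewrite [RHS]exchange_big /=.
  apply: eq_bigr => -[[[xi xi'] zeta] a] _.
  rewrite base_eqs_natr mulrCA mulr_sumr mulr_sumr; apply: eq_bigr => i _.
  congr (_ * _); rewrite /symchar !big_split /=.
  have splitM (I : finType) (phi : I -> mulcfun F) (nu : mulcfun F) (u : I -> {unit F}) :
      \prod_k (phi k * nu) (u k) = (\prod_k phi k (u k)) * \prod_k nu (u k).
    by rewrite -big_split; apply: eq_bigr => k _; rewrite cfunE.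
  by rewrite !splitM; ring.
rewrite /hypergeom; set pref := (X in _ * X * (_ * _)); set S := (X in _ * (_ * X)).
have -> : (1 - #|F|%:R)^-1 = - (#|F|%:R - 1)^-1 :> algC by rewrite -invrN opprB.
(* Passing from 1 - q to q - 1 absorbs one sign, so (-1)^(n+1) becomes (-1)^n. *)
transitivity ((#|F|%:R - 1)^-1 * ((-1) ^+ n * pref * S)); last first.
  by rewrite exprS; ring.
congr (_ * _); rewrite {}/S mulr_sumr; apply: eq_bigr => i _.
set nu := 'chi_i; have Lnu : nu \is a linear_char by exact: mulchar_irr_lin.
have Lnu' : nu^-1 \is a linear_char by rewrite rpredV.
set s := nu (unitN1 F).
have s2 : s * s = 1 by exact: mulchar_unitN1_sqr.
rewrite /term -/s.
(* In each [- s], the minus sign comes from the definition of the Jacobi sum and s = nu(-1) from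
   [jacobi_twist]. *)
have -> : \prod_k \sum_u \sum_v (val u + val v == 1 :> F)%:R *
      ((alpha k * nu) u * (beta k * nu^-1) v) =
    \prod_k ((- s) * (jacobi (alpha k) (beta k) *
                       (poch psi (alpha k) nu / pocho psi (beta k)^-1 nu))).
  apply: eq_bigr => k _; transitivity (- jacobi (alpha k * nu) (beta k * nu^-1)).
    rewrite opprK; apply: eq_bigr => u _; rewrite [RHS]big_mkcond /=.
    by apply: eq_bigr => v _; rewrite mulr_natl mulrb.
  by rewrite (jacobi_twist _ psi) // -/s; ring.
(* Only the terms x = u survive, leaving a Gauss sum rescaled by [c k]. The factors nu(c k) later
   combine into the value of nu at the product of the [c k]. *)
have -> : \prod_k \sum_u \sum_x (x == val u)%:R *
      (psi (c k * x) * (gamma k * nu^-1) u) =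
    \prod_k ((- s) * ((gauss psi (gamma k) * mulchar_ext (gamma k)^-1 (c k)) *
              (mulchar_ext nu (c k) / pocho psi (gamma k)^-1 nu))).
  apply: eq_bigr => k _.
  transitivity (- (gauss psi (gamma k * nu^-1) *
                   mulchar_ext (gamma k * nu^-1)^-1 (c k))).
    rewrite -(sum_unit_gauss _ psi) ?rpredM ?gamma_char //; apply: eq_bigr => u _.
    rewrite (bigD1 (val u)) //= eqxx mul1r big1 ?addr0 // => x /negPf->.
    by rewrite mul0r.
  have -> : mulchar_ext (gamma k * nu^-1)^-1 (c k) =
            mulchar_ext (gamma k)^-1 (c k) * mulchar_ext nu (c k).
    have [d <-] := @exists_unit F _ (c_neq0 k); rewrite !mulchar_extE.
    by rewrite invrM ?lin_char_unitr // invrK mulrC cfunE.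
  by rewrite gauss_twist // -/s; ring.
rewrite mulchar_extM // mulchar_extE mulchar_ext_prod //.
rewrite big_cat /= !prod_map_enum /pref.
(* The Pochhammer symbols are generalized so as to be atoms for the splitting of products and for
   [ring]. *)
move: (poch psi) (pocho psi) => P O; rewrite !big_split /=.
rewrite !prodfV !prodr_const !card_ord.
(* The [m] Jacobi and [n - m] Gauss factors give (-s)^n, by [le_mn]; with the s^n of [term] this is
   (-s^2)^n, and s^2 = 1. *)
have -> : ((-1) ^+ n : algC) = s ^+ n * ((- s) ^+ m * (- s) ^+ (n - m)).
  by rewrite -exprD subnKC // -exprMn mulrN s2.
by rewrite invfM; ring.
Qed.
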